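(* Let $\mathcal{E}$ be a collection of spaces. Let there be given a commutative diagram with rows $C\xleftarrow{g}A\xrightarrow{f}B$ and $C'\xleftarrow{g'}A'\xrightarrow{f'}B'$ and vertical maps $c:C\to C'$, $a:A\to A'$, $b:B\to B'$ (so $cg=g'a$ and $bf=f'a$). Let $D$ and $D'$ be the homotopy pushouts of the first and second rows, respectively, and let $d:D\to D'$ be the induced map. Then $$\mathcal{E}\text{-}\mathrm{secat}(d)\le \mathcal{E}\text{-}\mathrm{secat}(b)+\mathcal{E}\text{-}\mathrm{secat}(c)+1.$$
   Context: All spaces are assumed to have the homotopy type of connected CW-complexes; spaces have no base points and maps are not required to preserve base points. A collection $\mathcal{E}$ of spaces means any collection of spaces containing the one-point space $*$. Given $f:X\to Y$, a subset $U\subseteq Y$ with inclusion $i:U\hookrightarrow Y$ is $\mathcal{E}$-section-categorical (with respect to $f$) if there are a space $E\in\mathcal{E}$ and maps $u:U\to E$, $v:E\to X$ with $fvu\simeq i$. The (reduced) $\mathcal{E}$-sectional category $\mathcal{E}\text{-}\mathrm{secat}(f)$ is the smallest integer $n\ge 0$ such that $Y$ has an open cover by $n+1$ subsets each of which is $\mathcal{E}$-section-categorical with respect to $f$ (and $\infty$ if no such $n$ exists). The homotopy pushout of $C\xleftarrow{g}A\xrightarrow{f}B$ is the quotient of $B\cup(A\times[0,1])\cup C$ (disjoint union) by the identifications $(a,0)\sim f(a)$, $(a,1)\sim g(a)$ for $a\in A$; it is functorial for commutative maps of such diagrams. *)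

(* Defs.v *)
From HB Require Import structures.
From Stdlib Require Import Relation_Operators.
From mathcomp Require Import all_boot all_order all_algebra.
From mathcomp Require Import generic_quotient.
From mathcomp Require Import all_classical all_reals all_analysis.

Set Implicit Arguments.
Unset Strict Implicit.
Unset Printing Implicit Defensive.

Import Order.TTheory GRing.Theory Num.Theory.
Import numFieldNormedType.Exports.

Local Open Scope classical_set_scope.
Local Open Scope ring_scope.
Local Open Scope quotient_scope.

(* [R] is the model of the real numbers; every space-level notion below depends
   on it only through the unit interval and the Euclidean disks. *)

Definition unit_interval (R : realType) : topologicalType :=
  set_type (`[0, 1]%classic : set R).

Lemma mem_interval0 (R : realType) : (0 : R) \in (`[0, 1]%classic : set R).
Proof. by apply/mem_set; rewrite /= in_itv /= lexx ler01. Qed.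

Lemma mem_interval1 (R : realType) : (1 : R) \in (`[0, 1]%classic : set R).
Proof. by apply/mem_set; rewrite /= in_itv /= ler01 lexx. Qed.

Definition interval0 (R : realType) : unit_interval R :=
  exist _ 0 (mem_interval0 R).

Definition interval1 (R : realType) : unit_interval R :=
  exist _ 1 (mem_interval1 R).

Arguments interval0 {R}.
Arguments interval1 {R}.

(* Free homotopy (no base points); continuity of [f] and [g] is implied. *)
Definition homotopic (R : realType) (X Y : topologicalType) (f g : X -> Y) :
    Prop :=
  exists H : X * unit_interval R -> Y,
    [/\ continuous H,
        forall x, H (x, interval0) = f x &
        forall x, H (x, interval1) = g x].

Definition homotopy_equivalent (R : realType) (X Y : topologicalType) : Prop :=
  exists (f : X -> Y) (g : Y -> X),
    [/\ continuous f, continuous g,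
        homotopic R (g \o f) id & homotopic R (f \o g) id].

(* The topology of ['rV[R]_n] is the product topology, so the Euclidean disk,
   ball and sphere are cut out with the sum of squares and not with the
   library's norm on matrices, which is the maximum norm. *)
Definition sqnorm (R : realType) (n : nat) (x : 'rV[R]_n) : R :=
  \sum_(i < n) x ord0 i ^+ 2.

Definition edisk (R : realType) (n : nat) : set 'rV[R]_n :=
  [set x | sqnorm x <= 1].

Definition eball (R : realType) (n : nat) : set 'rV[R]_n :=
  [set x | sqnorm x < 1].

Definition esphere (R : realType) (n : nat) : set 'rV[R]_n :=
  [set x | sqnorm x = 1].

Arguments edisk : clear implicits.
Arguments eball : clear implicits.
Arguments esphere : clear implicits.

(* A characteristic map is given on all of R^n, but only its restriction to the
   closed disk matters. *)
Record cw_structure (R : realType) (K : topologicalType) := CWStructure {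
  cw_cell : Type;
  cw_dim : cw_cell -> nat;
  cw_char : forall e : cw_cell, 'rV[R]_(cw_dim e) -> K;
  cw_hausdorff : hausdorff_space K;
  cw_char_continuous : forall e : cw_cell,
    {within edisk R (cw_dim e), continuous (@cw_char e)};
  (* each characteristic map is a homeomorphism from the open ball onto its
     image *)
  cw_char_homeo : forall e : cw_cell, exists h : K -> 'rV[R]_(cw_dim e),
    {within @cw_char e @` eball R (cw_dim e), continuous h} /\
    (forall x, eball R (cw_dim e) x -> h (@cw_char e x) = x);
  cw_cover : forall y : K, exists e : cw_cell,
    (@cw_char e @` eball R (cw_dim e)) y;
  cw_disjoint : forall (e e' : cw_cell) (y : K),
    (@cw_char e @` eball R (cw_dim e)) y ->
    (@cw_char e' @` eball R (cw_dim e')) y -> e = e';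
  cw_closure_finite : forall e : cw_cell, exists F : set cw_cell,
    [/\ finite_set F,
        forall e', F e' -> (cw_dim e' < cw_dim e)%N &
        @cw_char e @` esphere R (cw_dim e) `<=`
          \bigcup_(e' in F) (@cw_char e' @` eball R (cw_dim e'))];
  cw_weak_topology : forall S : set K,
    closed S <-> (forall e : cw_cell,
      closed (edisk R (cw_dim e) `&` @cw_char e @^-1` S))
}.

(* The library counts the empty set as connected; a connected complex is
   required to be nonempty. *)
Definition has_connected_cw_type (R : realType) (X : topologicalType) : Prop :=
  exists K : topologicalType,
    [/\ inhabited (cw_structure R K), [set: K] !=set0, connected [set: K] &
        homotopy_equivalent R X K].

Definition collection_of_spaces (R : realType) (E : topologicalType -> Prop) :
    Prop :=
  (forall X : topologicalType, E X -> has_connected_cw_type R X) /\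
  (exists2 P : topologicalType, E P & exists pt : P, [set: P] = [set pt]).

Section Secat.
Variables (R : realType) (E : topologicalType -> Prop).
Variables (X Y : topologicalType) (f : X -> Y).

Definition section_categorical (U : set Y) : Prop :=
  exists (Z : topologicalType) (u : set_type U -> Z) (v : Z -> X),
    [/\ E Z, continuous u, continuous v &
        homotopic R (f \o v \o u) (set_val : set_type U -> Y)].

Definition section_categorical_cover (n : nat) : Prop :=
  exists U : 'I_n.+1 -> set Y,
    [/\ forall i, open (U i),
        \bigcup_i U i = [set: Y] &
        forall i, section_categorical (U i)].

Definition secat : \bar int :=
  match pselect (exists n, `[< section_categorical_cover n >]) with
  | left ex_cover => ((ex_minn ex_cover)%:Z)%:E
  | right _ => +oo%E
  end.

End Secat.

Variant piece := PieceB | PieceCyl | PieceC.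

Definition option_of_piece (p : piece) : option bool :=
  match p with PieceB => Some true | PieceCyl => None | PieceC => Some false end.

Definition piece_of_option (o : option bool) : piece :=
  match o with
  | Some true => PieceB | None => PieceCyl | Some false => PieceC
  end.

Lemma option_of_pieceK : cancel option_of_piece piece_of_option.
Proof. by case. Qed.

HB.instance Definition _ := Choice.copy piece (can_type option_of_pieceK).

Section HomotopyPushout.
Variables (R : realType) (A B C : topologicalType).

Definition piece_space (p : piece) : topologicalType :=
  match p with
  | PieceB => B
  | PieceCyl => (A * unit_interval R)%type
  | PieceC => C
  end.

Definition pieces : topologicalType := {p : piece & piece_space p}.

Definition inB (x : B) : pieces := existT piece_space PieceB x.
Definition inCyl (x : A * unit_interval R) : pieces :=
  existT piece_space PieceCyl x.
Definition inC (x : C) : pieces := existT piece_space PieceC x.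

Variables (f : A -> B) (g : A -> C).

Variant glue : pieces -> pieces -> Prop :=
  | glue0 x : glue (inCyl (x, interval0)) (inB (f x))
  | glue1 x : glue (inCyl (x, interval1)) (inC (g x)).

Definition glue_equiv (x y : pieces) : bool :=
  `[< clos_refl_sym_trans _ glue x y >].

Lemma glue_equiv_refl : reflexive glue_equiv.
Proof. by move=> x; apply/asboolP; exact: rst_refl. Qed.

Lemma glue_equiv_sym : symmetric glue_equiv.
Proof.
by move=> x y; apply/asboolP/asboolP => xy; exact: rst_sym.
Qed.

Lemma glue_equiv_trans : transitive glue_equiv.
Proof.
by move=> y x z /asboolP xy /asboolP yz; apply/asboolP; exact: rst_trans yz.
Qed.

Definition glue_rel :=
  EquivRel glue_equiv glue_equiv_refl glue_equiv_sym glue_equiv_trans.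

Definition hpushout := {eq_quot glue_rel}.

HB.instance Definition _ :=
  Topological.copy hpushout (quotient_topology hpushout).
HB.instance Definition _ := Quotient.on hpushout.

End HomotopyPushout.

Section HomotopyPushoutMap.
Variables (R : realType) (A B C A' B' C' : topologicalType).
Variables (f : A -> B) (g : A -> C) (f' : A' -> B') (g' : A' -> C').
Variables (a : A -> A') (b : B -> B') (c : C -> C').

Definition pieces_map (x : pieces R A B C) : pieces R A' B' C' :=
  match x with
  | existT PieceB y => inB R A' C' (b y)
  | existT PieceCyl y => inCyl B' C' (a y.1, y.2)
  | existT PieceC y => inC R A' B' (c y)
  end.

(* The value does not depend on the representative when the two squares
   commute: see [hpushout_mapE]. *)
Definition hpushout_map (x : hpushout R f g) : hpushout R f' g' :=
  \pi_(hpushout R f' g') (pieces_map (repr x)).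

Lemma hpushout_mapE : c \o g = g' \o a -> b \o f = f' \o a ->
  forall x, hpushout_map (\pi_(hpushout R f g) x) =
            \pi_(hpushout R f' g') (pieces_map x).
Proof.
move=> cg bf x; rewrite /hpushout_map; apply/eqmodP/asboolP => /=.
have bfE z : b (f z) = f' (a z) by exact: (congr1 (@^~ z) bf).
have cgE z : c (g z) = g' (a z) by exact: (congr1 (@^~ z) cg).
have mapP y z : clos_refl_sym_trans _ (glue f g) y z ->
    clos_refl_sym_trans _ (glue f' g') (pieces_map y) (pieces_map z).
  elim=> {y z} [_ _ [] z /=|z|y z _|y z t _ yz _ zt].
  - by rewrite bfE; apply: rst_step; exact: glue0.
  - by rewrite cgE; apply: rst_step; exact: glue1.
  - exact: rst_refl.
  - exact: rst_sym.
  - exact: rst_trans yz zt.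
apply: mapP; apply/asboolP.
by have /eqmodP : repr (\pi_(hpushout R f g) x) = x
  %[mod hpushout R f g] by rewrite reprK.
Qed.

Lemma pieces_map_continuous :
  continuous a -> continuous b -> continuous c -> continuous pieces_map.
Proof.
move=> ca cb cc [] [] x.
- exact: (@continuous_comp _ _ _ b (@inB R A' B' C') x (cb x)
    (@existT_continuous _ _ PieceB (b x))).
- apply: (@continuous_comp _ _ _ (fun y => (a y.1, y.2)) (@inCyl R A' B' C') x).
    have cax : {for x, continuous (fun y : A * unit_interval R => a y.1)}.
      by apply: (@continuous_comp _ _ _ fst a x); [exact: cvg_fst|exact: ca].
    have cx : {for x, continuous (@snd A (unit_interval R))} by exact: cvg_snd.
    exact: (cvg_pair cax cx).
  exact: (@existT_continuous _ (piece_space R A' B' C') PieceCyl).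
- exact: (@continuous_comp _ _ _ c (@inC R A' B' C') x (cc x)
    (@existT_continuous _ _ PieceC (c x))).
Qed.

Lemma hpushout_map_continuous : c \o g = g' \o a -> b \o f = f' \o a ->
  continuous a -> continuous b -> continuous c -> continuous hpushout_map.
Proof.
move=> cg bf ca cb cc; apply/quotient_continuous.
rewrite (_ : _ \o _ = \pi_(hpushout R f' g') \o pieces_map).
  move=> x; apply: continuous_comp; first exact: pieces_map_continuous.
  exact: pi_continuous.
by apply/funext => x; exact: hpushout_mapE.
Qed.

End HomotopyPushoutMap.

Arguments hpushout_map R {A B C A' B' C'} f g f' g' a b c x.

(* Main.v *)
From Stdlib Require Import Relation_Operators.
Require Import Defs.
From mathcomp Require Import all_boot all_order all_algebra.
From mathcomp Require Import generic_quotient.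
From mathcomp Require Import all_classical all_reals all_analysis.
From mathcomp Require Import lra.

Set Implicit Arguments.
Unset Strict Implicit.
Unset Printing Implicit Defensive.

Import Order.TTheory GRing.Theory Num.Theory.
Import numFieldNormedType.Exports.

Local Open Scope classical_set_scope.
Local Open Scope ring_scope.
Local Open Scope quotient_scope.

(** Write D' as the double mapping cylinder of C' <- A' -> B', with t the
cylinder coordinate. The open set t < 2/3 (containing B') deforms inside D'
onto B' by pushing the cylinder coordinate to 0, with final map the projection
(x, t) |-> f' x; likewise t > 1/3 deforms onto C'. These two open sets cover
D'. Let U be section-categorical for b, witnessed by U -> Z -> B, and let W be
the preimage of U under the projection of t < 2/3 to B'. Then W -> U -> Z -> B
-> D followed by d is W -> U -> Z -> B -> B' -> D', which is homotopic first to
W -> U -> D' and then, by the deformation, to the inclusion of W in D'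
([section_categorical_deformation]). So n + 1 sets for b and m + 1 sets for c
pull back to n + m + 2 open sets of D' that are section-categorical for d
([section_categorical_cover_cat]).

The topological point is the continuity of the deformations: they are defined
on representatives, on the disjoint union of the three pieces times the
parameter space, while their source is the quotient D' times the parameter
space. The product of a quotient map with a locally compact Hausdorff space is
again a quotient map, because a function of two variables factors through the
quotient once it is curried ([quotient_prod_continuous]). Homotopies are
reparametrized by the real line ([homotopicP]) through the retraction [clamp]
onto the unit interval: the line is locally compact and Hausdorff, and
reversing or concatenating homotopies becomes arithmetic of reals. *)

(** * Continuity in products and subspaces *)

Lemma continuous_pair (S T U : topologicalType) (h : S -> T) (k : S -> U) :
  continuous h -> continuous k -> continuous (fun x => (h x, k x)).
Proof. by move=> ch ck x; apply: cvg_pair; [exact: ch|exact: ck]. Qed.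

Lemma continuous_compT (S T U : topologicalType) (h : T -> U) (k : S -> T) :
  continuous h -> continuous k -> continuous (h \o k).
Proof. by move=> ch ck x; apply: continuous_comp; [exact: ck|exact: ch]. Qed.

Lemma fst_continuous (S T : topologicalType) : continuous (@fst S T).
Proof. by move=> x; exact: cvg_fst. Qed.

Lemma snd_continuous (S T : topologicalType) : continuous (@snd S T).
Proof. by move=> x; exact: cvg_snd. Qed.

Lemma set_val_continuous (T : topologicalType) (S : set T) :
  continuous (val : set_type S -> T).
Proof. exact: initial_continuous. Qed.

Lemma continuous_comp_val (S T : topologicalType) (D : set T)
    (h : S -> set_type D) : continuous (val \o h) -> continuous h.
Proof. exact: continuous_comp_initial. Qed.

(** The curried function descends to the quotient as a map into the function
space with the compact-open topology, and local compactness of [V] makes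
uncurrying preserve continuity. *)
Lemma quotient_prod_continuous (T V W : topologicalType) (Q : quotType T)
    (F : quotient_topology Q * V -> W) :
  locally_compact [set: V] -> hausdorff_space V ->
  continuous (fun p : T * V => F (\pi_(quotient_topology Q) p.1, p.2)) ->
  continuous F.
Proof.
move=> lcV hV cF.
have <- : uncurry (curry F) = F by apply/funext => -[].
have [cc ccp] := continuous_curry cF.
apply: continuous_uncurry => //.
  by apply/(@quotient_continuous T Q {compact-open, V -> W} (curry F)).
by move=> u; rewrite -[u]reprK; exact: ccp.
Qed.

Lemma sigT_prod_continuous (I : choiceType) (X : I -> topologicalType)
    (V W : topologicalType) (F : {i & X i} * V -> W) :
  (forall i, continuous (fun p : X i * V => F (existT X i p.1, p.2))) ->
  continuous F.
Proof.
move=> cF [[i x] s] U nU; have [[P Q] /= [nP nQ] PQU] := cF i (x, s) U nU.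
exists (existT X i @` P, Q) => /=; first by split=> //; exact: existT_nbhs.
by move=> [_ v] /= [[y Py <-] Qv]; exact: (PQU (y, v)).
Qed.

(** * Homotopies parametrized by the real line *)

Section Clamp.
Variable R : realType.

Lemma mem_clamp (t : R) : Num.max 0 (Num.min t 1) \in (`[0, 1]%classic : set R).
Proof.
apply/mem_set; rewrite /= in_itv /=.
by rewrite le_max lexx ge_max ler01 ge_min lexx orbT.
Qed.

Definition clamp (t : R) : unit_interval R :=
  exist _ (Num.max 0 (Num.min t 1)) (mem_clamp t).

Lemma clamp_le0 (t : R) : t <= 0 -> clamp t = interval0.
Proof.
move=> t0; apply: val_inj => /=; apply: max_l.
by rewrite ge_min t0.
Qed.

Lemma clamp_ge1 (t : R) : 1 <= t -> clamp t = interval1.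
Proof. by move=> t1; apply: val_inj => /=; rewrite min_r// max_r. Qed.

Lemma interval_ge0 (t : unit_interval R) : 0 <= val t.
Proof. by case: t => t /= /set_mem /=; rewrite in_itv /= => /andP[]. Qed.

Lemma interval_le1 (t : unit_interval R) : val t <= 1.
Proof. by case: t => t /= /set_mem /=; rewrite in_itv /= => /andP[]. Qed.

Lemma clamp_val (t : unit_interval R) : clamp (val t) = t.
Proof.
apply: val_inj => /=; rewrite min_l ?interval_le1// max_r//.
exact: interval_ge0.
Qed.

Lemma clamp_continuous : continuous clamp.
Proof.
apply: continuous_comp_val => t.
have c1 : {for t, continuous (fun s : R => Num.min s 1)}.
  apply: (@continuous_min R _ (fun s : R => s) (cst 1)).
    exact: cvg_id.
  exact: cvg_cst.
apply: (@continuous_max R _ (cst 0) (fun s : R => Num.min s 1)) => //.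
exact: cvg_cst.
Qed.

End Clamp.

Section RealParameter.
Variable R : realType.

(** Precomposition with [clamp] extends a homotopy from the unit interval to
the line without changing its ends. *)
Lemma homotopicP (X Y : topologicalType) (h k : X -> Y) :
  homotopic R h k <->
  exists G : X * R -> Y,
    [/\ continuous G, forall x, G (x, 0) = h x & forall x, G (x, 1) = k x].
Proof.
split=> -[H [cH H0 H1]].
  exists (fun p => H (p.1, clamp p.2)); split.
  - apply: (continuous_compT cH); apply: continuous_pair.
      exact: fst_continuous.
    by apply: continuous_compT; [exact: clamp_continuous|exact: snd_continuous].
  - by move=> x /=; rewrite clamp_le0.
  - by move=> x /=; rewrite clamp_ge1.
exists (fun p => H (p.1, val p.2)); split => //.
apply: (continuous_compT cH); apply: continuous_pair.
  exact: fst_continuous.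
exact: (continuous_compT (@set_val_continuous _ _)
          (@snd_continuous X (unit_interval R))).
Qed.

Lemma homotopic_sym (X Y : topologicalType) (h k : X -> Y) :
  homotopic R h k -> homotopic R k h.
Proof.
move=> /homotopicP[G [cG G0 G1]]; apply/homotopicP.
exists (fun p => G (p.1, 1 - p.2)); split.
- apply: (continuous_compT cG); apply: continuous_pair.
    exact: fst_continuous.
  by move=> p; apply: cvgB; [exact: cvg_cst|exact: cvg_snd].
- by move=> x /=; rewrite subr0.
- by move=> x /=; rewrite subrr.
Qed.

Lemma homotopic_trans (X Y : topologicalType) (h k l : X -> Y) :
  homotopic R h k -> homotopic R k l -> homotopic R h l.
Proof.
move=> /homotopicP[G [cG G0 G1]] /homotopicP[H [cH H0 H1]].
(* The parameter is truncated in each half, so that both halves are continuous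
   on the whole of [X * R] and pasting applies to two closed sets. *)
pose G' (p : X * R) := G (p.1, Num.min (2 * p.2) 1).
pose H' (p : X * R) := H (p.1, Num.max (2 * p.2 - 1) 0).
have c2 : continuous (fun p : X * R => 2 * p.2).
  by move=> p; apply: cvgM; [exact: cvg_cst|exact: cvg_snd].
have cG' : continuous G'.
  apply: (continuous_compT cG); apply: continuous_pair.
    exact: fst_continuous.
  by move=> p; apply: (@continuous_min R _ (fun p : X * R => 2 * p.2) (cst 1));
    [exact: c2|exact: cvg_cst].
have cH' : continuous H'.
  apply: (continuous_compT cH); apply: continuous_pair.
    exact: fst_continuous.
  move=> p; apply: (@continuous_max R _ (fun p : X * R => 2 * p.2 - 1) (cst 0));
    last exact: cvg_cst.
  by apply: cvgB; [exact: c2|exact: cvg_cst].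
apply/homotopicP.
pose K p := if p.2 <= 2^-1 then G' p else H' p.
exists K; split.
- pose L := [set p : X * R | p.2 <= 2^-1].
  pose M := [set p : X * R | 2^-1 <= p.2].
  have cL : closed L.
    have /continuous_closedP/(_ _ (@closed_le R 2^-1)) := @snd_continuous X R.
    exact.
  have cM : closed M.
    have /continuous_closedP/(_ _ (@closed_ge R 2^-1)) := @snd_continuous X R.
    exact.
  have LM : [set: X * R] = L `|` M.
    apply/seteqP; split=> // -[x t] _; rewrite /L /M /=.
    by case: (leP t 2^-1) => [|/ltW]; [left|right].
  apply/continuous_subspace_setT; rewrite LM.
  apply: withinU_continuous => //.
  + apply: (subspace_eq_continuous (f := G')); last exact: continuous_subspaceT.
    by move=> p /set_mem /= pL; rewrite /from_subspace /K pL.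
  + apply: (subspace_eq_continuous (f := H')); last exact: continuous_subspaceT.
    move=> -[x t] /set_mem; rewrite /M /= => pM; rewrite /from_subspace /K /=.
    case: leP => // tL; have -> : t = 2^-1 by lra.
    rewrite /G' /H' /= divff// minxx subrr maxxx.
    by rewrite G1 H0.
- by move=> x; rewrite /K /G' /= ifT; [rewrite mulr0 min_l|lra].
- move=> x; rewrite /K /H' /= ifF; last by apply/negbTE; rewrite -ltNge; lra.
  have -> : Num.max (2 * 1 - 1) 0 = 1 :> R by rewrite max_l; lra.
  exact: H1.
Qed.

Lemma homotopic_comp (W X Y Z : topologicalType) (p : W -> X) (h k : X -> Y)
    (q : Y -> Z) : continuous p -> continuous q ->
  homotopic R h k -> homotopic R (q \o h \o p) (q \o k \o p).
Proof.
move=> cp cq [H [cH H0 H1]]; exists (fun z => q (H (p z.1, z.2))); split.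
- apply: (continuous_compT cq); apply: (continuous_compT cH).
  apply: continuous_pair; last exact: snd_continuous.
  by apply: continuous_compT; [exact: cp|exact: fst_continuous].
- by move=> x /=; rewrite H0.
- by move=> x /=; rewrite H1.
Qed.

End RealParameter.

(** * Section-categorical sets along a deformation *)

(** The option type encodes a partial map [r], defined on the part of [Y] that
the homotopy [G] deforms, inside [Y], into the image of [j]. The first
condition says at once that the domain of [r] is open and that [r] is
continuous on it. *)
Definition deforms_into (R : realType) (Y Y0 : topologicalType)
    (r : Y -> option Y0) (j : Y0 -> Y) : Prop :=
  (forall U, open U -> open (r @^-1` (Some @` U))) /\
  exists G : Y * R -> Y,
    [/\ continuous G, forall y, G (y, 0) = y &
        forall y z, r y = Some z -> G (y, 1) = j z].

(** On the preimage [W] of [U] under [r], the homotopy from [d0 v u] to the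
inclusion of [U] gives [d i v u r = j d0 v u r ~ j r], and the deformation run
backwards joins [j r] to the inclusion of [W]. *)
Lemma section_categorical_deformation (R : realType)
    (E : topologicalType -> Prop) (X Y X0 Y0 : topologicalType) (d : X -> Y)
    (d0 : X0 -> Y0) (i : X0 -> X) (j : Y0 -> Y) (r : Y -> option Y0)
    (U : set Y0) :
  continuous i -> continuous j -> d \o i = j \o d0 -> deforms_into R r j ->
  section_categorical R E d0 U ->
  section_categorical R E d (r @^-1` (Some @` U)).
Proof.
move=> ci cj dij [or [G [cG G0 G1]]] [Z [u [v [EZ cu cv uv]]]].
set W := _ @^-1` _.
have /choice[rho rhoE] (w : set_type W) :
    exists z : set_type U, r (val w) = Some (val z).
  case: w => w /= /[dup] wW /set_mem[z Uz rwz].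
  by exists (exist _ z (mem_set Uz)); rewrite rwz.
have crho : continuous rho.
  apply: continuous_comp_val; apply/continuousP => O oO.
  rewrite (_ : _ @^-1` _ = val @^-1` (r @^-1` (Some @` O))).
    by have /continuousP cW := @set_val_continuous Y W; exact/cW/or.
  apply/seteqP; split=> w /=; last by move=> [z Oz]; rewrite rhoE => -[<-].
  by move=> Ow; exists (val (rho w)); rewrite // rhoE.
exists Z, (u \o rho), (i \o v); split => //.
- exact: continuous_compT.
- exact: continuous_compT.
have dE x : d (i x) = j (d0 x) by exact: (congr1 (@^~ x) dij).
have -> : d \o (i \o v) \o (u \o rho) = j \o (d0 \o v \o u) \o rho.
  by apply/funext => w /=; rewrite dE.
apply: (homotopic_trans (homotopic_comp crho cj uv)).
apply/homotopic_sym/homotopicP.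
exists (fun p => G (val p.1, p.2)); split.
- apply: (continuous_compT cG); apply: continuous_pair.
    exact: (continuous_compT (@set_val_continuous _ _) (@fst_continuous _ _)).
  exact: snd_continuous.
- by move=> w /=; rewrite G0.
- by move=> w /=; apply: G1; exact: rhoE.
Qed.

(** * Sliding along the cylinder of a homotopy pushout *)

Section Slide.
Variables (R : realType) (A B C : topologicalType) (f : A -> B) (g : A -> C).

Lemma repr_hpushoutE (S : Type) (h : pieces R A B C -> S) :
  (forall x, h (inCyl B C (x, interval0)) = h (inB R A C (f x))) ->
  (forall x, h (inCyl B C (x, interval1)) = h (inC R A B (g x))) ->
  forall p, h (repr (\pi_(hpushout R f g) p)) = h p.
Proof.
move=> h0 h1 p.
have hE y z : clos_refl_sym_trans _ (Defs.glue f g) y z -> h y = h z.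
  elim=> {y z} [_ _ [] //|//|y z _ -> //|y z t _ -> _ -> //].
apply: hE; apply/asboolP.
by have /eqmodP : repr (\pi_(hpushout R f g) p) = p
  %[mod hpushout R f g] by rewrite reprK.
Qed.

Definition slide (phi : unit_interval R * R -> unit_interval R)
    (p : pieces R A B C) (s : R) : pieces R A B C :=
  match p with
  | existT PieceB y => inB R A C y
  | existT PieceCyl x => inCyl B C (x.1, phi (x.2, s))
  | existT PieceC z => inC R A B z
  end.

(** A deformation of the interval with fixed ends induces one of the homotopy
pushout. All conditions are stated on the pieces, where they can be checked
separately on [B], [C] and the cylinder. *)
Lemma hpushout_deforms_into (Y0 : topologicalType)
    (phi : unit_interval R * R -> unit_interval R)
    (rho : pieces R A B C -> option Y0) (j : Y0 -> hpushout R f g) :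
  continuous phi ->
  (forall s, phi (interval0, s) = interval0) ->
  (forall s, phi (interval1, s) = interval1) ->
  (forall t, phi (t, 0) = t) ->
  (forall x, rho (inCyl B C (x, interval0)) = rho (inB R A C (f x))) ->
  (forall x, rho (inCyl B C (x, interval1)) = rho (inC R A B (g x))) ->
  (forall i U, open U ->
    open [set x : piece_space R A B C i |
           (Some @` U) (rho (existT (piece_space R A B C) i x))]) ->
  (forall p z, rho p = Some z ->
    \pi_(hpushout R f g) (slide phi p 1) = j z) ->
  deforms_into R (rho \o repr : hpushout R f g -> option Y0) j.
Proof.
move=> cphi phi0 phi1 phis0 rho0 rho1 orho slide1; split.
  move=> U oU.
  have piU : open (rho @^-1` (Some @` U)).
    by apply/sigT_openP => i; exact: orho.
  rewrite /open /= /quotient_open.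
  rewrite (_ : _ @^-1` _ = rho @^-1` (Some @` U))//.
  by apply/seteqP; split=> p /=; rewrite repr_hpushoutE.
pose F p s := \pi_(hpushout R f g) (slide phi p s).
have glue0E x : \pi_(hpushout R f g) (inCyl B C (x, interval0)) =
    \pi_(hpushout R f g) (inB R A C (f x)).
  by apply/eqmodP/asboolP; apply: rst_step; exact: Defs.glue0.
have glue1E x : \pi_(hpushout R f g) (inCyl B C (x, interval1)) =
    \pi_(hpushout R f g) (inC R A B (g x)).
  by apply/eqmodP/asboolP; apply: rst_step; exact: Defs.glue1.
have FE p s : F (repr (\pi_(hpushout R f g) p)) s = F p s.
  apply: (repr_hpushoutE (h := F^~ s)) => x; rewrite /F /=.
    by rewrite phi0.
  by rewrite phi1.
exists (fun q => F (repr q.1) q.2); split.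
- apply: quotient_prod_continuous.
  + exact: locally_compactR.
  + exact: Rhausdorff.
  rewrite (_ : (fun p => _) = (fun p => F p.1 p.2)); last first.
    by apply/funext => p; exact: FE.
  apply: continuous_compT; first exact: pi_continuous.
  apply: sigT_prod_continuous => -[] /=.
  + exact: (continuous_compT (@existT_continuous _ _ PieceB)
              (@fst_continuous _ _)).
  + apply: (continuous_compT (@existT_continuous _ _ PieceCyl)).
    apply: continuous_pair.
      exact: (continuous_compT (@fst_continuous _ _) (@fst_continuous _ _)).
    apply: (continuous_compT cphi); apply: continuous_pair.
      exact: (continuous_compT (@snd_continuous _ _) (@fst_continuous _ _)).
    exact: snd_continuous.
  + exact: (continuous_compT (@existT_continuous _ _ PieceC)
              (@fst_continuous _ _)).
- move=> y; rewrite /F -[RHS]reprK /=; congr (\pi _).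
  by case: (repr y) => -[] // [x t]; rewrite /= phis0.
- by move=> y z ryz; exact: slide1.
Qed.

End Slide.

(** * The two collars *)

Section Collars.
Variables (R : realType) (A B C : topologicalType) (f : A -> B) (g : A -> C).

(** The bounds 2/3 and 1/3 overlap, so that the two domains cover the homotopy
pushout while each stays away from the opposite end of the cylinder. *)
Definition collarB (p : pieces R A B C) : option B :=
  match p with
  | existT PieceB y => Some y
  | existT PieceCyl x => if val x.2 < 2 / 3 then Some (f x.1) else None
  | existT PieceC _ => None
  end.

Definition collarC (p : pieces R A B C) : option C :=
  match p with
  | existT PieceB _ => None
  | existT PieceCyl x => if 1 / 3 < val x.2 then Some (g x.1) else None
  | existT PieceC z => Some z
  end.

Lemma collar_cover (p : pieces R A B C) :
  (exists y, collarB p = Some y) \/ (exists z, collarC p = Some z).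
Proof.
case: p => -[y|[x t]|z] /=; [by left; exists y| |by right; exists z].
case: ltP => [_|t23]; first by left; exists (f x).
by right; exists (g x); rewrite ifT//; lra.
Qed.

Lemma open_collar (T : topologicalType) (h : A -> T)
    (b : pred R) (U : set T) :
  continuous h -> open [set t : R | b t] -> open U ->
  open [set x : A * unit_interval R |
         (Some @` U) (if b (val x.2) then Some (h x.1) else None)].
Proof.
move=> ch ob oU.
rewrite (_ : [set x | _] =
    (h \o fst) @^-1` U `&` (val \o snd) @^-1` [set t : R | b t]).
  apply: openI.
    have /continuousP := continuous_compT ch (@fst_continuous A (unit_interval R)).
    exact.
  have /continuousP := continuous_compT
    (@set_val_continuous R `[0, 1]%classic) (@snd_continuous A (unit_interval R)).
  exact.
apply/seteqP; split=> -[x t] /=.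
  by case: ifP => [_ [z Uz [<-]]|_ [] //].
by move=> [Uhx ->]; exists (h x).
Qed.

Lemma continuous_clamp_comp (T : topologicalType) (h : T -> R) :
  continuous h -> continuous (@clamp R \o h).
Proof. by apply: continuous_compT; exact: clamp_continuous. Qed.

(** At parameter 1 the slide sends [t] to [3t - 2], which is nonpositive exactly
for [t <= 2/3]. The absolute value keeps 0 fixed for negative parameters too. *)
Lemma collarB_deforms_into : continuous f ->
  deforms_into R (collarB \o repr : hpushout R f g -> option B)
    (\pi_(hpushout R f g) \o inB R A C).
Proof.
move=> cf.
pose phi (q : unit_interval R * R) : unit_interval R :=
  clamp (val q.1 - 2 * `|q.2| * (1 - val q.1)).
apply: (@hpushout_deforms_into _ _ _ _ _ _ _ phi).
- apply: continuous_clamp_comp => q.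
  have cv : {for q, continuous (fun q : unit_interval R * R => val q.1 : R)}.
    exact: (continuous_compT (@set_val_continuous R _) (@fst_continuous _ _)).
  apply: cvgB; first exact: cv.
  apply: cvgM; last by apply: cvgB; [exact: cvg_cst|exact: cv].
  apply: cvgM; first exact: cvg_cst.
  by apply: cvg_norm; exact: cvg_snd.
- by move=> s; apply: clamp_le0 => /=; have := normr_ge0 s; lra.
- by move=> s; apply: clamp_ge1 => /=; lra.
- by move=> t; rewrite /phi /= normr0 mulr0 mul0r subr0 clamp_val.
- by move=> x /=; rewrite ifT//; lra.
- by move=> x /=; rewrite ifF//; apply/negbTE; rewrite -leNgt; lra.
- case=> U oU /=.
  + rewrite (_ : [set x | _] = U)//; apply/seteqP; split=> y /=.
      by move=> [z Uz [<-]].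
    by move=> Uy; exists y.
  + by apply: (open_collar (b := fun t => t < 2 / 3)) => //; exact: open_lt.
  + rewrite (_ : [set x | _] = set0)//; first exact: open0.
    by apply/seteqP; split=> // y /= [].
- move=> [[y|[x t]|//] z] /=; first by move=> [->].
  case: ifP => // t23 [<-]; rewrite /phi /= clamp_le0; last first.
    by rewrite normr1; lra.
  by apply/eqmodP/asboolP; apply: rst_step; exact: Defs.glue0.
Qed.

(** Mirror image of [collarB_deforms_into]: at parameter 1 the slide sends [t] to
[3t], which is at least 1 exactly for [t >= 1/3]. *)
Lemma collarC_deforms_into : continuous g ->
  deforms_into R (collarC \o repr : hpushout R f g -> option C)
    (\pi_(hpushout R f g) \o @inC R A B C).
Proof.
move=> cg.
pose phi (q : unit_interval R * R) : unit_interval R :=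
  clamp (val q.1 + 2 * `|q.2| * val q.1).
apply: (@hpushout_deforms_into _ _ _ _ _ _ _ phi).
- apply: continuous_clamp_comp => q.
  have cv : {for q, continuous (fun q : unit_interval R * R => val q.1 : R)}.
    exact: (continuous_compT (@set_val_continuous R _) (@fst_continuous _ _)).
  apply: cvgD; first exact: cv.
  apply: cvgM; last exact: cv.
  apply: cvgM; first exact: cvg_cst.
  by apply: cvg_norm; exact: cvg_snd.
- by move=> s; apply: clamp_le0 => /=; lra.
- by move=> s; apply: clamp_ge1 => /=; have := normr_ge0 s; lra.
- by move=> t; rewrite /phi /= normr0 mulr0 mul0r addr0 clamp_val.
- by move=> x /=; rewrite ifF//; apply/negbTE; rewrite -leNgt; lra.
- by move=> x /=; rewrite ifT//; lra.
- case=> U oU /=.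
  + rewrite (_ : [set x | _] = set0)//; first exact: open0.
    by apply/seteqP; split=> // y /= [].
  + by apply: (open_collar (b := fun t => 1 / 3 < t)) => //; exact: open_gt.
  + rewrite (_ : [set x | _] = U)//; apply/seteqP; split=> y /=.
      by move=> [z Uz [<-]].
    by move=> Uy; exists y.
- move=> [[//|[x t]|y] z] /=; last by move=> [->].
  case: ifP => // t13 [<-]; rewrite /phi /= clamp_ge1; last first.
    by rewrite normr1; lra.
  by apply/eqmodP/asboolP; apply: rst_step; exact: Defs.glue1.
Qed.

End Collars.

(** * Sectional category and covers *)

Lemma secat_le (R : realType) (E : topologicalType -> Prop)
    (X Y : topologicalType) (f : X -> Y) (n : nat) :
  section_categorical_cover R E f n -> (secat R E f <= n%:Z%:E)%E.
Proof.
move=> fn; rewrite /secat; case: pselect => [ex|[]]; last first.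
  by exists n; apply/asboolP.
by case: ex_minnP => m _ /(_ n); rewrite lee_fin lez_nat; apply; apply/asboolP.
Qed.

Lemma secat_cover (R : realType) (E : topologicalType -> Prop)
    (X Y : topologicalType) (f : X -> Y) :
  secat R E f = +oo%E \/
  exists2 n : nat, secat R E f = n%:Z%:E & section_categorical_cover R E f n.
Proof.
rewrite /secat; case: pselect => [ex|_]; [right|by left].
by case: ex_minnP => n /asboolP fn _; exists n.
Qed.

Lemma section_categorical_cover_cat (R : realType)
    (E : topologicalType -> Prop) (X Y : topologicalType) (d : X -> Y)
    (n m : nat) (U : 'I_n.+1 -> set Y) (V : 'I_m.+1 -> set Y) :
  (forall i, open (U i)) -> (forall i, open (V i)) ->
  (forall i, section_categorical R E d (U i)) ->
  (forall i, section_categorical R E d (V i)) ->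
  \bigcup_i U i `|` \bigcup_i V i = [set: Y] ->
  section_categorical_cover R E d (n + m).+1.
Proof.
move=> oU oV scU scV UV.
have nmE : (n + m).+2 = (n.+1 + m.+1)%N by rewrite addnS addSn.
pose W (k : 'I_(n.+1 + m.+1)) :=
  match fintype.split k with inl i => U i | inr i => V i end.
exists (W \o cast_ord nmE); split.
- by move=> k; rewrite /= /W; case: fintype.split.
- apply/seteqP; split=> // y _.
  have : (\bigcup_i U i `|` \bigcup_i V i) y by rewrite UV.
  case=> -[i _ yi].
    exists (cast_ord (esym nmE) (unsplit (inl i))) => //.
    by rewrite /comp cast_ordKV /W unsplitK.
  exists (cast_ord (esym nmE) (unsplit (inr i))) => //.
  by rewrite /comp cast_ordKV /W unsplitK.
- by move=> k; rewrite /= /W; case: fintype.split.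
Qed.

Theorem theorem3p9 (R : realType) (E : topologicalType -> Prop)
    (hE : collection_of_spaces R E)
    (A B C A' B' C' : topologicalType)
    (hA : has_connected_cw_type R A) (hB : has_connected_cw_type R B)
    (hC : has_connected_cw_type R C) (hA' : has_connected_cw_type R A')
    (hB' : has_connected_cw_type R B') (hC' : has_connected_cw_type R C')
    (f : A -> B) (g : A -> C) (f' : A' -> B') (g' : A' -> C')
    (a : A -> A') (b : B -> B') (c : C -> C')
    (hf : continuous f) (hg : continuous g)
    (hf' : continuous f') (hg' : continuous g')
    (ha : continuous a) (hb : continuous b) (hc : continuous c)
    (hcg : c \o g = g' \o a) (hbf : b \o f = f' \o a) :
  (secat R E (hpushout_map R f g f' g' a b c)
     <= secat R E b + secat R E c + 1)%E.
Proof.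
have [->|[n -> [U [oU covU scU]]]] := secat_cover R E b.
  by case: (secat_cover R E c) => [->|[m ->]]; rewrite leey.
have [->|[m -> [V [oV covV scV]]]] := secat_cover R E c; first by rewrite leey.
have -> : (n%:Z%:E + m%:Z%:E + 1 = (n + m).+1%:Z%:E)%E.
  by rewrite -!EFinD -!PoszD addn1.
apply: secat_le.
pose rB : hpushout R f' g' -> option B' := @collarB R A' B' C' f' \o repr.
pose rC : hpushout R f' g' -> option C' := @collarC R A' B' C' g' \o repr.
have dB : deforms_into R rB _ := collarB_deforms_into R g' hf'.
have dC : deforms_into R rC _ := collarC_deforms_into R f' hg'.
have cB (K L M : topologicalType) (k : K -> L) (l : K -> M) :
    continuous (\pi_(hpushout R k l) \o inB R K M).
  apply: continuous_compT; first exact: pi_continuous.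
  exact: (@existT_continuous _ _ PieceB).
have cC (K L M : topologicalType) (k : K -> L) (l : K -> M) :
    continuous (\pi_(hpushout R k l) \o @inC R K L M).
  apply: continuous_compT; first exact: pi_continuous.
  exact: (@existT_continuous _ _ PieceC).
apply: (section_categorical_cover_cat
  (U := fun i => rB @^-1` (Some @` U i)) (V := fun i => rC @^-1` (Some @` V i))).
- by move=> i; exact: dB.1.
- by move=> i; exact: dC.1.
- move=> i; apply: (section_categorical_deformation (cB _ _ _ f g) _ _ dB) => //.
    exact: cB.
  by apply/funext => y; exact: hpushout_mapE.
- move=> i; apply: (section_categorical_deformation (cC _ _ _ f g) _ _ dC) => //.
    exact: cC.
  by apply/funext => y; exact: hpushout_mapE.
apply/seteqP; split=> // y _.
have [[z rz]|[z rz]] := collar_cover f' g' (repr y); [left|right].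
  have [i _ Uz] : (\bigcup_i U i) z by rewrite covU.
  by exists i => //; exists z.
have [i _ Vz] : (\bigcup_i V i) z by rewrite covV.
by exists i => //; exists z.
Qed.
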